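(* Let $G$ be a finite connected undirected graph (multiple edges and loops allowed), let $<$ be a total order on $E(G)$ and let $A$ be a full orientation of $G$. Each partial orientation $\mathcal{O}$ of $G$ is equivalent via cycle reversals to a unique partial orientation that is cycle minimal with respect to $(<,A)$. Moreover, this cycle minimal partial orientation can be obtained greedily: starting from $\mathcal{O}$ and repeatedly reversing nonminimal directed cycles, in any order, as long as there is one, the process terminates after finitely many steps in this cycle minimal partial orientation.
   Context: A partial orientation of $G$ is an orientation of a subset of the edges; the remaining edges are unoriented (each edge, including each loop, has two possible orientations or is unoriented). A full orientation orients every edge. A directed cycle in a partial orientation is a cycle of $G$ all of whose edges are oriented, consistently along the cycle; an oriented loop is a directed cycle of length 1, and two parallel edges oriented oppositely form a directed cycle of length 2. A cycle reversal reverses the orientation of all edges in a directed cycle (for a loop, it switches between its two orientations). Two partial orientations are equivalent via cycle reversals if one can be obtained from the other by a finite (possibly empty) sequence of cycle reversals. Given $(<,A)$, a directed cycle is minimal if its minimum edge with respect to $<$ is oriented in the same direction as in $A$, and nonminimal otherwise. A partial orientation is cycle minimal if every directed cycle in it is minimal. *)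

(* Defs.v *)
From HB Require Import structures.
From Stdlib Require Export Relation_Operators.
From mathcomp Require Export all_boot all_order.

Set Implicit Arguments.
Unset Strict Implicit.
Unset Printing Implicit Defensive.

Import Order.TTheory.

(* Each edge e has two ends, [ends e true] and [ends e false], which coincide
   when e is a loop.  The booleans only name the two half-edges: they carry no
   preferred direction, and they give every edge, loops included, exactly two
   orientations. *)
Record multigraph (V E : finType) := Multigraph { ends : E -> bool -> V }.

Section Orientations.
Variables (V : finType) (d : Order.disp_t) (E : finOrderType d).
Variable G : multigraph V E.

Definition adjacent : rel V :=
  [rel u v | [exists e : E, exists b : bool,
                (ends G e b == u) && (ends G e (~~ b) == v)]].

Definition connected : Prop :=
  0 < #|V| /\ forall u v : V, connect adjacent u v.

(* [O e = Some b] : e is oriented from [ends G e b] to [ends G e (~~ b)];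
   [O e = None] : e is unoriented. *)
Definition orientation : Type := {ffun E -> option bool}.

Definition full (A : orientation) : Prop := forall e : E, A e <> None.

(* The edge x.1 traversed from [ends G x.1 x.2] to its other end. *)
Definition dart : Type := (E * bool)%type.

Definition tail (x : dart) : V := ends G x.1 x.2.
Definition head (x : dart) : V := ends G x.1 (~~ x.2).

Definition edges (c : seq dart) : seq E := [seq x.1 | x <- c].

(* A cycle of G, given with a starting point and a direction of traversal:
   a nonempty closed walk without repeated vertices or edges. *)
Definition graph_cycle (c : seq dart) : bool :=
  [&& c != [::], cycle [rel x y | head x == tail y] c,
      uniq [seq tail x | x <- c] & uniq (edges c)].

Definition directed_cycle (O : orientation) (c : seq dart) : bool :=
  graph_cycle c && all (fun x => O x.1 == Some x.2) c.

Definition reverse (O : orientation) (c : seq dart) : orientation :=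
  [ffun e => if e \in edges c then omap negb (O e) else O e].

Definition cycle_reversal (O O' : orientation) : Prop :=
  exists2 c, directed_cycle O c & O' = reverse O c.

Definition reversal_equiv : orientation -> orientation -> Prop :=
  clos_refl_trans orientation cycle_reversal.

Definition is_min_edge (e : E) (c : seq dart) : bool :=
  (e \in edges c) && all (fun f => (e <= f)%O) (edges c).

Definition minimal (A O : orientation) (c : seq dart) : bool :=
  [exists e, is_min_edge e c && (O e == A e)].

Definition cycle_minimal (A O : orientation) : Prop :=
  forall c, directed_cycle O c -> minimal A O c.

Definition greedy_step (A O O' : orientation) : Prop :=
  exists c, [/\ directed_cycle O c, ~~ minimal A O c & O' = reverse O c].

(* Accessibility: no infinite sequence of greedy steps starts from O. *)
Definition greedy_terminates (A O : orientation) : Prop :=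
  Acc (fun O2 O1 => greedy_step A O1 O2) O.

(* O' is reached from O by greedy steps, and no further step is possible. *)
Definition greedy_outcome (A O O' : orientation) : Prop :=
  clos_refl_trans orientation (greedy_step A) O O' /\
  forall O'', ~ greedy_step A O' O''.

End Orientations.

(* Main.v *)
Require Import Defs.
From mathcomp Require Import all_boot all_order.
From Stdlib Require Import Classical.

(** Why the theorem is true.

    Termination.  Reversing a nonminimal directed cycle makes its minimum edge
    agree with [A] and leaves every smaller edge alone.  Reading orientations
    lexicographically along the edge order, each greedy step therefore moves
    strictly closer to [A] ([greedy_step_closer]), and a strict order on the
    finite set of orientations has no infinite ascending chain.  A greedy run
    can only stop at a cycle minimal orientation, which gives existence.

    Uniqueness.  A cycle reversal preserves the set of unoriented edges and
    the number of edges leaving each vertex ([card_out_edges_reverse]).  Let two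
    distinct orientations share these data, and consider the darts of the
    first that the second orients oppositely.  If such a dart enters [v],
    then another one leaves [v], for otherwise the second orientation would
    have strictly more edges leaving [v].  So one can walk along such darts
    forever and close up a directed cycle of the first orientation whose
    reversal is a directed cycle of the second ([opposite_cycle]).  Both
    cycles have the same minimum edge, oriented oppositely, so they cannot
    both be minimal. *)

Set Implicit Arguments.
Unset Strict Implicit.
Unset Printing Implicit Defensive.

Import Order.TTheory.

Section CycleReversals.
Variables (V : finType) (d : Order.disp_t) (E : finOrderType d).
Variable G : multigraph V E.
Implicit Types (A O : orientation E) (c : seq (dart E)) (x y : dart E) (v : V).

(** * Directed cycles and their opposites *)

Definition flip x : dart E := (x.1, ~~ x.2).

Definition opposite c : seq (dart E) := rev (map flip c).

Lemma tail_flip x : tail G (flip x) = Defs.head G x.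
Proof. by []. Qed.

Lemma head_flip x : Defs.head G (flip x) = tail G x.
Proof. by rewrite /tail /Defs.head /= negbK. Qed.

Lemma edges_opposite c : edges (opposite c) = rev (edges c).
Proof. by rewrite /edges /opposite map_rev -map_comp. Qed.

Lemma heads_cycle c :
  cycle [rel x y | Defs.head G x == tail G y] c ->
  map (Defs.head G) c = rot 1 (map (tail G) c).
Proof.
case: c => [//|x p] /= xp; rewrite rot1_cons -map_rcons.
have: forall q y, path [rel x y | Defs.head G x == tail G y] y q ->
    map (Defs.head G) (belast y q) = map (tail G) q.
  by elim=> [//|z q IHq] y /= /andP[/eqP-> /IHq->].
by move=> /(_ _ _ xp); rewrite belast_rcons.
Qed.

Lemma graph_cycle_opposite c : graph_cycle G c -> graph_cycle G (opposite c).
Proof.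
case/and4P=> c_n0 cyc_c uniq_t uniq_e; apply/and4P; split.
- by rewrite -size_eq0 size_rev size_map size_eq0.
- rewrite rev_cycle cycle_map; congr (is_true _): cyc_c.
  apply: eq_cycle => x y /=.
  by rewrite head_flip tail_flip eq_sym.
- rewrite map_rev rev_uniq -map_comp.
  have -> : map (tail G \o flip) c = map (Defs.head G) c by apply: eq_map.
  by rewrite heads_cycle // rot_uniq.
- by rewrite edges_opposite rev_uniq.
Qed.

Lemma directed_cycle_opposite O c :
  graph_cycle G c -> all (fun x => O x.1 == Some (~~ x.2)) c ->
  directed_cycle G O (opposite c).
Proof.
move=> gc Oc; rewrite /directed_cycle graph_cycle_opposite //=.
by rewrite all_rev all_map; apply: sub_all Oc.
Qed.

(** * Invariants of cycle reversal *)

Definition out_edges O v : {set E} :=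
  [set e | if O e is Some b then tail G (e, b) == v else false].

Lemma card_out_edges_in O c v : uniq (edges c) ->
  #|out_edges O v :&: [set e in edges c]|
    = count (fun x => x.1 \in out_edges O v) c.
Proof.
move=> uniq_e; rewrite -(count_map fst (mem (out_edges O v))) -size_filter.
rewrite -(card_uniqP (filter_uniq _ uniq_e)); apply: eq_card => e.
by rewrite mem_filter in_setI [e \in [set _ in _]]inE.
Qed.

(** Along a closed walk the heads are a rotation of the tails, so the edges of
    the cycle contribute equally to [v] before and after the reversal. *)
Lemma card_out_edges_reverse O c v : directed_cycle G O c ->
  #|out_edges (reverse O c) v| = #|out_edges O v|.
Proof.
case/andP=> /and4P[_ cyc_c _ uniq_e] /allP Oc.
rewrite -(cardsID [set e in edges c]) -[RHS](cardsID [set e in edges c]).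
congr (_ + _); last first.
  apply: eq_card => e; rewrite !inE; case: (boolP (e \in edges c)) => //= e_nc.
  by rewrite ffunE (negbTE e_nc).
rewrite !card_out_edges_in //.
transitivity (count (pred1 v) (map (Defs.head G) c)).
  rewrite count_map; apply: eq_in_count => x xc.
  by rewrite !inE ffunE map_f //= (eqP (Oc x xc)).
rewrite heads_cycle // (permP (permEl (perm_rot _ _))) count_map.
apply: eq_in_count => x xc.
by rewrite !inE (eqP (Oc x xc)); case: (x).
Qed.

Definition same_invariants O O' : Prop :=
  (forall e, (O e == None) = (O' e == None)) /\
  (forall v, #|out_edges O v| = #|out_edges O' v|).

Lemma reversal_equiv_invariants O O' :
  reversal_equiv G O O' -> same_invariants O O'.
Proof.
elim=> {O O'} [O O' [c dc ->]|O|O O' O'' _ [un1 out1] _ [un2 out2]] //.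
- split=> [e|v]; last by rewrite card_out_edges_reverse.
  by rewrite ffunE; case: ifP => // _; case: (O e).
- by split=> [e|v]; rewrite ?un1 ?out1.
Qed.

(** * Uniqueness *)

(** Following [g], which picks a dart of [D] leaving each vertex, the walk
    eventually repeats a vertex since [V] is finite; one period of that walk
    visits no vertex twice.  Injectivity of [fst] on [D] then rules out repeated
    edges. *)
Lemma cycle_of_successors (D : {pred dart E}) x0 :
    {in D &, injective fst} -> x0 \in D ->
    (forall x, x \in D -> exists2 y, y \in D & tail G y = Defs.head G x) ->
  exists2 c, graph_cycle G c & {subset c <= D}.
Proof.
move=> injD Dx0 succD.
pose g v := odflt x0 [pick y in D | tail G y == v].
pose h v := Defs.head G (g v).
pose good v := (g v \in D) /\ tail G (g v) = v.
have goodP y : y \in D -> good (tail G y).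
  rewrite /good /g => Dy; case: pickP => [z /andP[Dz /eqP]|/(_ y)] //=.
  by rewrite Dy eqxx.
have good_h v : good v -> good (h v).
  by case=> Dg _; rewrite /h; have [y Dy <-] := succD _ Dg; apply: goodP.
pose v0 := tail G x0.
have good_iter n : good (iter n h v0).
  by elim: n => [|n IHn]; [apply: goodP | apply: good_h].
have [i lt_i eq_i] := trajectP (looping_order h v0).
set n := order h v0 in lt_i eq_i.
pose u := iter i h v0.
have cyc_u : fcycle h (orbit h u).
  apply/(orbitPcycle 0 3); exists (n - i).-1.
  by rewrite prednK ?subn_gt0 // -iterD subnK // ltnW.
have good_orbit v : v \in orbit h u -> good v.
  by case/trajectP=> j _ ->; rewrite -iterD.
have tails : map (tail G) (map g (orbit h u)) = orbit h u.
  by rewrite -map_comp; apply: map_id_in => v /good_orbit[].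
have sD : {subset map g (orbit h u) <= D}.
  by move=> x /mapP[v /good_orbit[Dg _] ->].
have uniq_t : uniq (map (tail G) (map g (orbit h u))).
  by rewrite tails orbit_uniq.
exists (map g (orbit h u)) => //; apply/and4P; split=> //.
- by rewrite -size_eq0 !size_map size_orbit -lt0n order_gt0.
- rewrite cycle_map; apply: (sub_in_cycle (P := mem (orbit h u))) cyc_u.
    by move=> v w _ /good_orbit[_ gw]; rewrite /= gw.
  exact/allP.
- rewrite map_inj_in_uniq ?(map_uniq uniq_t) // => x y /sD Dx /sD Dy.
  exact: injD.
Qed.

(** The darts [D] of [O] that [O'] orients oppositely satisfy the successor
    condition of [cycle_of_successors], by counting: if a dart of [D] enters
    [v] and none leaves it, reorienting [D] only adds edges to those leaving
    [v], although the two counts agree. *)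
Lemma opposite_cycle O O' : same_invariants O O' -> O <> O' ->
  exists c, directed_cycle G O c /\ directed_cycle G O' (opposite c).
Proof.
case=> unE outE neqO.
pose D := [pred x : dart E | (O x.1 == Some x.2) && (O' x.1 == Some (~~ x.2))].
have injD : {in D &, injective fst}.
  move=> [e b] [f b'] /andP[/= /eqP Oe _] /andP[/= /eqP Of _] /= ef.
  by move: Of; rewrite -ef Oe => -[<-].
have [e neq_e] : exists e, O e != O' e.
  apply/existsP; rewrite -negb_forall; apply/forallP => eqO.
  by apply: neqO; apply/ffunP => e; apply/eqP.
have oppE f b : O f = Some b -> O f != O' f -> O' f = Some (~~ b).
  move=> Of; have:= unE f; rewrite Of.
  by case: (O' f) => [b'|] //= _; case: b b' {Of} => [] [].
have [b Oe] : exists b, O e = Some b.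
  have:= unE e; move: neq_e; case: (O e) => [b|]; first by exists b.
  by case: (O' e).
have De : (e, b) \in D by rewrite inE /= Oe (oppE e b) ?eqxx.
have succD x : x \in D -> exists2 y, y \in D & tail G y = Defs.head G x.
  move=> /andP[/eqP Ox /eqP O'x]; set v := Defs.head G x.
  case: (pickP [pred y in D | tail G y == v]) => [y /andP[Dy /eqP] | noD].
    by exists y.
  have Dout f : f \in out_edges O v -> O' f = O f.
    rewrite inE; case Of: (O f) => [b'|] // tf.
    apply/eqP; rewrite eq_sym -Of; apply: contraFT (noD (f, b')) => neq_f.
    by rewrite !inE tf /= Of (oppE f b') ?eqxx.
  (* With no dart of [D] leaving [v], the edge of [x] is new in [O']. *)
  suff /proper_card : out_edges O v \proper out_edges O' v.
    by rewrite outE ltnn.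
  apply/properP; split.
    by apply/subsetP => f f_out; have:= f_out; rewrite !inE Dout.
  exists x.1; first by rewrite inE O'x; apply: eqxx.
  apply/negP => /Dout; rewrite Ox O'x => -[].
  by case: (x.2).
have [c gc sD] := cycle_of_successors injD De succD.
exists c; split; last apply: directed_cycle_opposite => //.
  by rewrite /directed_cycle gc; apply/allP => x /sD /andP[].
by apply/allP => x /sD /andP[].
Qed.

Lemma cycle_minimal_unique A O O' : same_invariants O O' ->
  cycle_minimal G A O -> cycle_minimal G A O' -> O = O'.
Proof.
move=> inv minO minO'; apply: NNPP => neqO.
have [c [dc dc']] := opposite_cycle inv neqO.
have /existsP[e /andP[/andP[ec /allP le_e] /eqP Oe]] := minO _ dc.
have /existsP[f /andP[]] := minO' _ dc'.
rewrite /is_min_edge edges_opposite mem_rev all_rev.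
move=> /andP[fc /allP le_f] /eqP O'f.
have ef : e = f by apply/le_anti; rewrite le_e //= le_f.
case/mapP: ec => x xc ex.
have Ox : O x.1 = Some x.2 by case/andP: dc => _ /allP/(_ x xc)/eqP.
have : flip x \in opposite c by rewrite mem_rev map_f.
case/andP: dc' => _ /allP dc' /dc' /eqP /= O'x.
by move: O'f; rewrite -ef -Oe ex Ox O'x => -[]; case: (x.2).
Qed.

(** * Termination of the greedy procedure *)

(** The lexicographic order along the edge order, where on each edge the value
    taken by [A] ranks above all others. *)
Definition closer A O O' : bool :=
  [exists e, [&& O e != A e, O' e == A e &
              [forall f, (f < e)%O ==> (O' f == O f)]]].

Lemma closer_irr A O : closer A O O = false.
Proof. by apply/existsP => -[e /and3P[/negbTE->]]. Qed.

Lemma closer_trans A : transitive (closer A).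
Proof.
move=> O' O O'' /existsP[e /and3P[Oe O'e /forallP lt_e]].
case/existsP=> f /and3P[O'f O''f /forallP lt_f].
have eq_e a : (a < e)%O -> O' a = O a by move/(implyP (lt_e a))/eqP.
have eq_f a : (a < f)%O -> O'' a = O' a by move/(implyP (lt_f a))/eqP.
apply/existsP; case: (ltgtP e f) => [ef|fe|ef].
- exists e; rewrite Oe eq_f // O'e /=; apply/forallP => a; apply/implyP => ae.
  by rewrite eq_f ?eq_e // (lt_trans ae).
- exists f; rewrite -eq_e // O'f O''f /=; apply/forallP => a; apply/implyP => af.
  by rewrite eq_f ?eq_e // (lt_trans af).
- by rewrite -ef O'e in O'f.
Qed.

Lemma min_edge_exists c : c != [::] -> exists e, is_min_edge e c.
Proof.
case: c => [//|x c] _.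
have x_in : x.1 \in edges (x :: c) by rewrite inE eqxx.
case: (Order.TotalTheory.arg_minP id x_in) => e ec le_e.
by exists e; apply/andP; split=> //; apply/allP.
Qed.

Lemma greedy_step_closer A O O' : full A -> greedy_step G A O O' -> closer A O O'.
Proof.
move=> fullA [c [dc nmin ->]].
have /andP[/and4P[c_n0 _ _ _] /allP Oc] := dc.
have [e min_e] := min_edge_exists c_n0.
have neq_e : O e != A e.
  by apply: contra nmin => Oe; apply/existsP; exists e; rewrite min_e.
have /andP[ec /allP le_e] := min_e.
have [x xc ex] := mapP ec.
apply/existsP; exists e; rewrite neq_e /=; apply/andP; split.
  rewrite ffunE ec; move: neq_e; rewrite ex (eqP (Oc x xc)) -ex.
  by have:= fullA e; case: (A e) (x.2) => [[]|] [].
apply/forallP => f; apply/implyP => lt_f; rewrite ffunE.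
by case: ifP => // /le_e; rewrite leNgt lt_f.
Qed.

(** Induction on the number of orientations closer to [A] than [O]. *)
Lemma greedy_always_terminates A O : full A -> greedy_terminates G A O.
Proof.
move=> fullA.
have [n] := ubnP #|[set O' | closer A O O']|.
elim: n O => [O|n IHn O leOn]; first by rewrite ltn0.
constructor=> O' /(greedy_step_closer fullA) OO'.
apply: IHn; move: leOn; rewrite ltnS; apply: leq_trans; apply/proper_card/properP; split.
  by apply/subsetP => O''; rewrite !inE; apply: closer_trans.
by exists O'; rewrite inE ?OO' ?closer_irr.
Qed.

Lemma greedy_final_cycle_minimal A O :
  (forall O', ~ greedy_step G A O O') -> cycle_minimal G A O.
Proof.
move=> final c dc; apply: contraT => nmin.
by case: (final (reverse O c)); exists c.
Qed.

Lemma greedy_outcome_exists A O : full A -> exists O', greedy_outcome G A O O'.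
Proof.
move=> fullA; elim: (greedy_always_terminates O fullA) => {}O _ IH.
case: (classic (exists O', greedy_step G A O O')) => [[O' step]|no_step].
  have [O'' [run final]] := IH O' step.
  by exists O''; split=> //; apply: rt_trans run; apply: rt_step.
exists O; split=> [|O' step]; first exact: rt_refl.
by apply: no_step; exists O'.
Qed.

Lemma greedy_outcome_minimal A O O' : greedy_outcome G A O O' ->
  reversal_equiv G O O' /\ cycle_minimal G A O'.
Proof.
case=> run final; split; last exact: greedy_final_cycle_minimal.
elim: run => {O O' final} [O O' [c [dc _ ->]]|O|O O' O'' _ IH1 _ IH2].
- by apply: rt_step; exists c.
- exact: rt_refl.
- exact: rt_trans IH1 IH2.
Qed.

End CycleReversals.

Theorem theorem3p4 (V : finType) (d : Order.disp_t) (E : finOrderType d)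
    (G : multigraph V E) (hG : connected G)
    (A : orientation E) (hA : full A) (O : orientation E) :
  exists Omin : orientation E,
    [/\ unique (fun O' => reversal_equiv G O O' /\ cycle_minimal G A O') Omin,
        greedy_terminates G A O &
        forall O', greedy_outcome G A O O' -> O' = Omin].
Proof.
have uniq_min O1 O2 : reversal_equiv G O O1 /\ cycle_minimal G A O1 ->
    reversal_equiv G O O2 /\ cycle_minimal G A O2 -> O1 = O2.
  move=> [/reversal_equiv_invariants[un1 out1] min1].
  move=> [/reversal_equiv_invariants[un2 out2] min2].
  apply: (cycle_minimal_unique _ min1 min2).
  by split=> [e|v]; rewrite -?un1 -?out1.
have [Omin outcome] := greedy_outcome_exists G O hA.
have Omin_ok := greedy_outcome_minimal outcome.
exists Omin; split.
- by split=> // O'; apply: uniq_min.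
- exact: greedy_always_terminates.
- by move=> O' /greedy_outcome_minimal O'_ok; apply: uniq_min.
Qed.
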